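(* Let $q$ be a power of a prime $p$, let $n=p_1^{e_1}\cdots p_s^{e_s}$, where $p_1,\dots,p_s$ are distinct odd primes different from $p$ and $e_1,\dots,e_s$ are positive integers, and let $\eta=(\eta_1,\dots,\eta_s)$ be a primitive root system modulo $n$. For any applicable tuple $(y,x)\in\Sigma(n;q)$, the coset $c_{n/q}(\eta^{(y,x)})$ has size $$\tau_y=\omega_y\cdot p_1^{M_{y_1}}\cdots p_s^{M_{y_s}},$$ where, for $i=1,\dots,s$, $m_{y_i}=\min\{e_i-y_i,1\}$, $\omega_y=\mathrm{lcm}(\mathrm{ord}_{p_1^{m_{y_1}}}(q),\dots,\mathrm{ord}_{p_s^{m_{y_s}}}(q))$ and $M_{y_i}=\max\{e_i-y_i-v_{p_i}(q^{\omega_y}-1),0\}$.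
   Context: For $N\ge 1$ coprime to $q$ and an integer $\gamma$, $c_{N/q}(\gamma)=\{\gamma q^j \bmod N : j\ge0\}\subseteq\mathbb{Z}/N\mathbb{Z}$ is the $q$-cyclotomic coset modulo $N$ containing $\gamma$; its size is its cardinality. $v_\ell$ is the $\ell$-adic valuation; $\mathrm{ord}_N(q)$ is the multiplicative order of $q$ modulo $N$, with $\mathrm{ord}_1(q)=1$. An $s$-tuple $\eta=(\eta_1,\dots,\eta_s)$ of integers is a primitive root system modulo $p_1^{e_1}\cdots p_s^{e_s}$ if for every $i$: $\eta_i$ is a primitive root modulo $p_i^{d}$ for all $d\ge1$, and $\eta_i\equiv1\pmod{p_j^{e_j}}$ for every $j\ne i$. For $0\le y_i\le e_i$ put $f_{i,y_i}=\mathrm{ord}_{p_i^{e_i-y_i}}(q)$, $g_{i,y_i}=\phi(p_i^{e_i-y_i})/f_{i,y_i}$. $\Sigma(n;q)$ is the set of applicable tuples: $2s$-tuples of integers $(y,x)=(y_1,\dots,y_s,x_1,\dots,x_s)$ with $0\le y_i\le e_i$ and $0\le x_i\le g_{i,y_i}\gcd(\mathrm{lcm}(f_{1,y_1},\dots,f_{i-1,y_{i-1}}),f_{i,y_i})-1$ for all $i$ (for $i=1$ the gcd is understood to be $1$). Write $\eta^{(y,x)}=\eta_1^{x_1}\cdots\eta_s^{x_s}p_1^{y_1}\cdots p_s^{y_s}$ and $\tau_y=\mathrm{lcm}(f_{1,y_1},\dots,f_{s,y_s})=\mathrm{ord}_{p_1^{e_1-y_1}\cdots p_s^{e_s-y_s}}(q)$.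 *)

(* Defs.v *)
From mathcomp Require Import all_boot all_order all_fingroup all_algebra.
From mathcomp Require Import boolp.

Set Implicit Arguments.
Unset Strict Implicit.
Unset Printing Implicit Defensive.

(* Z/NZ is 'I_N rather than 'Z_N, which has two elements when N = 1. *)
Definition cyclotomic_coset (N q : nat) (gamma : int) : {set 'I_N} :=
  [set r : 'I_N |
    `[< exists j : nat, (r%:Z = gamma * q%:Z ^+ j %[mod N%:Z])%Z >]].

(* Meaningful for a coprime to N >= 1; otherwise insubd returns the unit 1. *)
Definition ord_mod (N : nat) (a : int) : nat :=
  if N == 1 then 1 else #[insubd (1%g : {unit 'Z_N}) (a%:~R : 'Z_N)%R]%g.

Definition primitive_root (N : nat) (a : int) : bool :=
  coprimez a N%:Z && (ord_mod N a == totient N).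

Section PrimePowers.

Variables (s : nat) (l e : 'I_s -> nat).

Definition modulus : nat := \prod_(i < s) l i ^ e i.

Definition primitive_root_system (eta : 'I_s -> int) : Prop :=
  forall i : 'I_s,
    (forall d : nat, 0 < d -> primitive_root (l i ^ d) (eta i)) /\
    (forall j : 'I_s, j != i -> (eta i = 1 %[mod (l j ^ e j)%:Z])%Z).

Variables (q : nat) (y : 'I_s -> nat).

Definition f_ (i : 'I_s) : nat := ord_mod (l i ^ (e i - y i)) q%:Z.

Definition g_ (i : 'I_s) : nat := totient (l i ^ (e i - y i)) %/ f_ i.

(* For the first index the lcm is empty, hence 1, and so is the gcd. *)
Definition applicable (x : 'I_s -> nat) : Prop :=
  forall i : 'I_s,
    y i <= e i /\
    x i < g_ i * gcdn (\big[lcmn/1]_(j < s | j < i) f_ j) (f_ i).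

Definition eta_pow (eta : 'I_s -> int) (x : 'I_s -> nat) : int :=
  ((\prod_(i < s) eta i ^+ x i) * (\prod_(i < s) (l i)%:Z ^+ y i))%R.

Definition tau : nat := \big[lcmn/1]_(i < s) f_ i.

Definition m_ (i : 'I_s) : nat := minn (e i - y i) 1.

Definition omega : nat := \big[lcmn/1]_(i < s) ord_mod (l i ^ m_ i) q%:Z.

(* Truncated subtraction is the maximum with 0. *)
Definition M_ (i : 'I_s) : nat := e i - y i - logn (l i) (q ^ omega - 1).

End PrimePowers.

(* Main.v *)
(* Writing k_i = e_i - y_i, both claims follow by comparing divisors. An exponent
   t is a multiple of tau_y iff every l_i ^ k_i divides q ^ t - 1. The eta part of
   gamma = eta^(y,x) is prime to n, so this says exactly that
   gamma * q ^ t = gamma modulo n, whence the size of the coset. On the other hand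
   such a t is a multiple omega * u of omega, and since l_i divides q ^ omega - 1
   when k_i > 0, lifting the exponent turns the condition into l_i ^ M_i | u for
   all i. *)
Require Import Defs.
From mathcomp Require Import all_boot all_order all_fingroup all_algebra cyclic.
From mathcomp Require Import boolp unstable.
From mathcomp Require Import ring zify.
Import GRing.Theory.

(** * Lifting the exponent at an odd prime *)

Lemma modn_exp_1D d (c i : nat) :
  (1 + c * d) ^ i = 1 + i * (c * d) %[mod d ^ 2].
Proof.
elim: i => [|i IHi]; first by rewrite expn0.
rewrite expnS -modnMmr IHi modnMmr.
have -> : (1 + c * d) * (1 + i * (c * d)) =
          i * c ^ 2 * d ^ 2 + (1 + i.+1 * (c * d)).
  rewrite -!mulnn; ring.
by rewrite modnMDl.
Qed.

Lemma geometric_sum_gt0 k q : 0 < k -> 0 < \sum_(i < k) q ^ i.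
Proof. by case: k => // k _; rewrite big_ord_recl expn0. Qed.

(* Oddness of l makes l divide 'C(l, 2), so that the sum is l modulo l ^ 2. *)
Lemma logn_geometric_sum_prime l Q : prime l -> odd l -> l %| Q - 1 -> 0 < Q ->
  logn l (\sum_(i < l) Q ^ i) = 1.
Proof.
move=> l_pr l_odd /dvdnP[c Qc] Q_gt0.
have {Qc Q_gt0}-> : Q = 1 + c * l by rewrite -Qc subnKC.
have l_gt1 := prime_gt1 l_pr.
have l_gt2 : 2 < l by case: l l_pr l_odd {l_gt1} => [|[|[|]]].
set S := \sum_(i < l) _.
have SE : S = l %[mod l ^ 2].
  rewrite -modn_summ; under eq_bigr do rewrite modn_exp_1D; rewrite modn_summ.
  rewrite big_split /= sum1_card card_ord -big_distrl /=.
  have /dvdnP[k ->] : l %| \sum_(i < l) i by rewrite -(big_mkord xpredT id) bin2_sum prime_dvd_bin.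
  have -> : l + k * l * (c * l) = k * c * l ^ 2 + l by rewrite -mulnn; ring.
  by rewrite modnMDl.
have S_gt0 : 0 < S by rewrite geometric_sum_gt0 // ltnW.
apply/eqP; rewrite eqn_leq leqNgt -!pfactor_dvdn // expn1; apply/andP; split.
  by rewrite /dvdn SE modn_small -?lt0n ?prime_gt0 // -mulnn ltn_Pmull ?prime_gt0.
have l_dvd_l2 : l %| l ^ 2 by rewrite dvdn_exp.
by rewrite /dvdn -(modn_dvdm _ l_dvd_l2) SE modn_dvdm // modnn.
Qed.

(** Strong induction on [u]. If [l] does not divide [u], the sum is [u] modulo [l], so both
    valuations vanish. If [u = v * l], the sum splits into one of length [l] in [Q], of valuation 1,
    and one of length [v] in [Q ^ l], to which induction applies. *)
Lemma logn_geometric_sum l Q u : prime l -> odd l -> l %| Q - 1 -> 0 < Q ->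
  0 < u -> logn l (\sum_(i < u) Q ^ i) = logn l u.
Proof.
move=> l_pr l_odd; have l_gt0 := prime_gt0 l_pr.
have [n] := ubnP u; elim: n u Q => // n IHn u Q le_un lQ Q_gt0 u_gt0.
have dvd_Xsub1 i : l %| Q ^ i - 1.
  by apply: dvdn_trans lQ _; rewrite !subn1 predn_exp dvdn_mulr.
have [/dvdnP[v uE]|l'u] := boolP (l %| u); last first.
  suff l'S : ~~ (l %| \sum_(i < u) Q ^ i) by rewrite !logn_coprime ?prime_coprime.
  rewrite /dvdn -modn_summ.
  have Q1 i : Q ^ i = 1 %[mod l] by apply/eqP; rewrite eqn_mod_dvd ?expn_gt0 ?Q_gt0.
  under eq_bigr do rewrite Q1.
  by rewrite modn_summ sum1_card card_ord.
have v_gt0 : 0 < v by case: v uE u_gt0 => // ->.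
have -> : \sum_(i < u) Q ^ i = (\sum_(i < l) Q ^ i) * \sum_(i < v) (Q ^ l) ^ i.
  (* The factorization is checked after multiplying by [Q - 1], which cannot be cancelled when
     [Q = 1]. *)
  have [Q1|Q_neq1] := eqVneq Q 1.
    rewrite Q1 exp1n.
    have sum1 k : \sum_(i < k) 1 ^ i = k.
      by under eq_bigr do rewrite exp1n; rewrite sum1_card card_ord.
    by rewrite !sum1 uE mulnC.
  have Q1_gt0 : 0 < Q.-1 by case: Q Q_gt0 Q_neq1 {lQ dvd_Xsub1} => [|[]].
  apply/eqP; rewrite -(eqn_pmul2l Q1_gt0) mulnA -!predn_exp -expnM.
  by rewrite uE mulnC.
rewrite lognM ?geometric_sum_gt0 // logn_geometric_sum_prime // IHn ?expn_gt0 ?Q_gt0 //.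
  by rewrite uE lognM // (logn_prime l l_pr) eqxx addnC.
by rewrite -ltnS; apply: leq_trans le_un; rewrite ltnS uE ltn_Pmulr // prime_gt1.
Qed.

(** Factoring [Q ^ u - 1] as [Q - 1] times a geometric sum adds [logn l u] to the valuation of
    [Q - 1]. The case [u = 0] is apart because [logn l 0] is 0, not infinite. *)
Lemma pfactor_dvd_expn_sub1 l k Q u : prime l -> odd l -> l %| Q - 1 -> 1 < Q ->
  (l ^ k %| Q ^ u - 1) = (l ^ (k - logn l (Q - 1)) %| u).
Proof.
move=> l_pr l_odd lQ Q_gt1; have [->|u_gt0] := posnP u; first by rewrite !dvdn0.
have Qu_gt1 : 1 < Q ^ u by rewrite -{1}(exp1n u) ltn_exp2r.
rewrite !pfactor_dvdn // ?subn_gt0 // !subn1 predn_exp.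
have Q_gt0 := ltnW Q_gt1; rewrite lognM ?geometric_sum_gt0 // ?logn_geometric_sum -?subn1 ?subn_gt0 //.
by rewrite leq_subLR.
Qed.

Lemma dvdn_ord_mod N q t : 0 < N -> coprime N q -> 0 < q ->
  (ord_mod N q%:Z %| t) = (N %| q ^ t - 1).
Proof.
rewrite /ord_mod; case: eqP => [->|/eqP N1]; first by rewrite !dvd1n.
move=> N_gt0 co_Nq q_gt0.
have N_gt1 : 1 < N by lia.
rewrite order_dvdn -val_eqE FinRing.val_unitX /= insubdK; last first.
  by rewrite unfold_in /= -pmulrn unitZpE.
rewrite -pmulrn -natrX -val_eqE /= !val_Zp_nat //.
by rewrite -eqn_mod_dvd ?expn_gt0 ?q_gt0 // Zp_cast.
Qed.

Lemma PoszX (m n : nat) : ((m ^ n)%N%:Z = m%:Z ^+ n)%R.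
Proof. by rewrite -[LHS]natz natrX natz. Qed.

Lemma dvdn_prod_pfactors s (l k : 'I_s -> nat) n :
  (forall i, prime (l i)) -> injective l ->
  reflect (forall i, l i ^ k i %| n) (\prod_(i < s) l i ^ k i %| n).
Proof.
move=> l_pr l_inj; apply: (iffP (Gauss_dvd_prod _ _)) => [| H i | H i _ _] //.
- rewrite filter_predT pairwise_map.
  have := index_enum_uniq 'I_s; rewrite uniq_pairwise; apply: sub_pairwise.
  move=> i j /= neq_ij.
  by rewrite coprimeXl // coprimeXr // prime_coprime // dvdn_prime2 // (inj_eq l_inj).
- exact: H (mem_index_enum i) isT.
Qed.

(** * Size of a cyclotomic coset *)

Section CosetSize.

Variables (N q T : nat) (gamma : int).
Hypotheses (N_gt0 : 0 < N) (T_gt0 : 0 < T) (co_Nq : coprime N q).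
(** [T] is the exact period of [gamma] under multiplication by [q] modulo [N]. *)
Hypothesis dvd_T :
  forall t, (T %| t) = (N%:Z %| (gamma * (q ^ t)%:Z - gamma)%R)%Z.

Lemma eqz_mod_gamma_expn i j :
  (gamma * q%:Z ^+ i == gamma * q%:Z ^+ j %[mod N])%Z = (i == j %[mod T]).
Proof.
wlog le_ji : i j / j <= i => [wlog_le|].
  have [/wlog_le //|/ltnW/wlog_le ji] := leqP j i.
  by rewrite eq_sym ji eq_sym.
rewrite eqz_mod_dvd eqn_mod_dvd // dvd_T PoszX.
have -> : (gamma * q%:Z ^+ i - gamma * q%:Z ^+ j =
           q%:Z ^+ j * (gamma * q%:Z ^+ (i - j) - gamma))%R.
  by rewrite -{1}(subnKC le_ji) exprD; ring.
by rewrite Gauss_dvdzr // coprimezXr.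
Qed.

(** The exponents below [T] enumerate the coset without repetition. *)
Lemma card_cyclotomic_coset : #|cyclotomic_coset N q gamma| = T.
Proof.
have N_neq0 : (N%:Z != 0)%R by rewrite eqz_nat -lt0n.
(* The default [Ordinal N_gt0] is never taken, a remainder modulo [N] being below [N]. *)
pose F (j : 'I_T) := insubd (Ordinal N_gt0) `|(gamma * q%:Z ^+ j %% N)%Z|%N.
have FE j : ((F j)%:Z = gamma * q%:Z ^+ j %% N)%Z.
  have ge0 := modz_ge0 (gamma * q%:Z ^+ j)%R N_neq0.
  rewrite insubdK ?gez0_abs // unfold_in -ltz_nat gez0_abs //.
  by rewrite ltz_pmod // ltz_nat.
have F_inj : injective F.
  move=> i j /(congr1 (fun r : 'I_N => Posz r)); rewrite !FE => /eqP.
  by rewrite eqz_mod_gamma_expn !modn_small // => /eqP/val_inj.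
rewrite -[RHS]card_ord -(card_imset _ F_inj); apply: eq_card => r.
rewrite inE; apply/asboolP/imsetP => [[j rj] | [j _ ->]]; last first.
  by exists j; rewrite FE modz_mod.
exists (Ordinal (ltn_pmod j T_gt0)) => //; apply/val_inj/eqP.
rewrite -eqz_nat FE /= -(@modz_small (Posz r) N) ?ltz_nat ?ltn_ord //.
by rewrite rj eqz_mod_gamma_expn modn_mod.
Qed.

End CosetSize.

(** * Orders and divisibility modulo products of prime powers *)

Section PrimePowerModuli.

Variables (q s : nat) (l e : 'I_s -> nat) (y : 'I_s -> nat).
Hypotheses (q_gt1 : 1 < q) (l_pr : forall i, prime (l i)).
Hypotheses (l_inj : injective l) (co_lq : forall i, coprime (l i) q).

(** The exponents [k] are left free so as to cover both [tau], with [e i - y i], and [omega], with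
    [m_]. *)
Lemma dvdn_biglcm_ordP (k : 'I_s -> nat) t :
  reflect (forall i, l i ^ k i %| q ^ t - 1)
          (\big[lcmn/1]_(i < s) ord_mod (l i ^ k i) q %| t).
Proof.
have dvd_ord i : (ord_mod (l i ^ k i) q %| t) = (l i ^ k i %| q ^ t - 1).
  by rewrite dvdn_ord_mod ?expn_gt0 ?(prime_gt0 (l_pr i)) ?coprimeXl // ltnW.
apply: (iffP (dvdn_biglcmP _ _ _)) => dvd_t i => [|_].
  by rewrite -dvd_ord; apply: dvd_t.
by rewrite dvd_ord; apply: dvd_t.
Qed.

Lemma ord_mod_gt0 N a : 0 < ord_mod N a.
Proof. by rewrite /ord_mod; case: ifP => // _; apply: order_gt0. Qed.

Lemma biglcmn_gt0 (I : finType) (F : I -> nat) :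
  (forall i, 0 < F i) -> 0 < \big[lcmn/1]_i F i.
Proof. by move=> F_gt0; elim/big_ind: _ => // m n; rewrite lcmn_gt0 => -> ->. Qed.

Lemma tau_gt0 : 0 < tau l e q y.
Proof. by apply: biglcmn_gt0 => i; apply: ord_mod_gt0. Qed.

Lemma omega_gt0 : 0 < omega l e q y.
Proof. by apply: biglcmn_gt0 => i; apply: ord_mod_gt0. Qed.

Lemma tauE : (forall i, odd (l i)) ->
  tau l e q y = omega l e q y * \prod_(i < s) l i ^ M_ l e q y i.
Proof.
move=> l_odd; set w := omega l e q y.
have w_gt0 : 0 < w := omega_gt0.
(* Lifting the exponent with base [q ^ w]. When [y i < e i], [m_] is 1, so [l i] divides [q ^ w - 1]
   by the choice of [w]. *)
have dvd_qw u i : (l i ^ (e i - y i) %| q ^ (w * u) - 1) =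
                  (l i ^ M_ l e q y i %| u).
  rewrite /M_ -/w; have [->|k_gt0] := posnP (e i - y i); first by rewrite !dvd1n.
  rewrite expnM; apply: pfactor_dvd_expn_sub1 => //.
    have /dvdn_biglcm_ordP/(_ i) := dvdnn w.
    by rewrite /m_ (minn_idPr k_gt0) expn1.
  by rewrite -(exp1n w) ltn_exp2r.
(* Natural numbers with the same multiples are equal. *)
suff dvdE t : (tau l e q y %| t) = (w * \prod_(i < s) l i ^ M_ l e q y i %| t).
  by apply/eqP; rewrite eqn_dvd dvdE dvdnn -dvdE dvdnn.
apply/dvdn_biglcm_ordP/idP => [dvd_t | /dvdnP[u ->] i].
  have /dvdnP[u tE] : w %| t.
    apply/dvdn_biglcm_ordP => i; apply: dvdn_trans (dvd_t i).
    by rewrite dvdn_exp2l // geq_minl.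
  rewrite tE mulnC dvdn_pmul2r //; apply/dvdn_prod_pfactors => // i.
  by rewrite -dvd_qw mulnC -tE.
rewrite mulnCA dvd_qw dvdn_mull //.
by have /dvdn_prod_pfactors -> := dvdnn (\prod_(j < s) l j ^ M_ l e q y j).
Qed.

(** One prime at a time: in [eta_pow] only the factor [l i ^ y i] is not prime to [l i], and it
    cancels against [l i ^ e i]. *)
Lemma dvdz_eta_pow (eta : 'I_s -> int) (x : 'I_s -> nat) (z : int) :
  (forall i, y i <= e i) -> (forall i j, coprimez (l j) (eta i)) ->
  reflect (forall i, ((l i ^ (e i - y i))%N%:Z %| z)%Z)
          ((modulus l e)%:Z %| (eta_pow l y eta x * z)%R)%Z.
Proof.
move=> le_ye co_l_eta.
have cancel_i i : ((l i ^ e i)%N%:Z %| (eta_pow l y eta x * z)%R)%Z =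
                  ((l i ^ (e i - y i))%N%:Z %| z)%Z.
  have co_prod k (P : pred _) (F : 'I_s -> int) : (forall j, P j -> coprimez (l i) (F j)) ->
      coprimez (l i ^ k)%N (\prod_(j < s | P j) F j)%R.
    move=> co_F; rewrite PoszX coprimezXl //.
    elim/big_ind: _ => [|a b co_a co_b|j /co_F] //; first by rewrite coprimezE coprimen1.
    by rewrite coprimezMr co_a.
  rewrite /eta_pow -mulrA Gauss_dvdzr; last first.
    by apply: co_prod => j _; rewrite coprimezXr.
  rewrite (bigD1 i) //= mulrAC Gauss_dvdzl; last first.
    apply: co_prod => j neq_ji; rewrite coprimezXr // coprimezE !absz_nat.
    by rewrite prime_coprime // dvdn_prime2 // (inj_eq l_inj) eq_sym.
  rewrite -{1}(subnKC (le_ye i)) expnD PoszM !PoszX dvdz_mul2l //.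
  by rewrite expf_neq0 // eqz_nat -lt0n prime_gt0.
apply: (iffP idP) => [dvd_N i | dvd_z].
  rewrite -cancel_i; apply: dvdz_trans dvd_N.
  by rewrite dvdzE /= /modulus (bigD1 i) //= dvdn_mulr.
by rewrite dvdzE /=; apply/dvdn_prod_pfactors => // i; have := dvd_z i; rewrite -cancel_i.
Qed.

End PrimePowerModuli.

(** For [j = i] this is part of being a primitive root modulo [l i]. Otherwise [eta i] is 1 modulo
    [l j], as [e j] is positive. *)
Lemma coprime_primitive_root_system s (l e : 'I_s -> nat) (eta : 'I_s -> int) :
  (forall i, 0 < e i) -> primitive_root_system l e eta ->
  forall i j, coprimez (l j) (eta i).
Proof.
move=> e_gt0 eta_prs i j; have [prim_i eta1] := eta_prs i.
have [->|neq_ji] := eqVneq j i.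
  by case/andP: (prim_i 1 isT) => + _; rewrite expn1 coprimez_sym.
move/eqP: (eta1 j neq_ji); rewrite eqz_mod_dvd => dvd_l.
have /dvdzP[k kE] : ((l j)%:Z %| (eta i - 1)%R)%Z.
  by apply: dvdz_trans dvd_l; rewrite dvdzE /= dvdn_exp.
by apply/coprimezP; exists (- k, 1)%R; rewrite /= mulNr -kE; ring.
Qed.

Theorem proposition3p3 (p q s : nat) (l e : 'I_s -> nat) (eta : 'I_s -> int)
    (y x : 'I_s -> nat)
    (p_prime : prime p)
    (q_power : exists2 a : nat, 0 < a & q = p ^ a)
    (l_prime : forall i, prime (l i))
    (l_odd : forall i, odd (l i))
    (l_neq_p : forall i, l i != p)
    (l_distinct : injective l)
    (e_gt0 : forall i, 0 < e i)
    (eta_prs : primitive_root_system l e eta)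
    (yx_applicable : applicable l e q y x) :
  #|cyclotomic_coset (modulus l e) q (eta_pow l y eta x)| = tau l e q y /\
  tau l e q y = omega l e q y * \prod_(i < s) l i ^ M_ l e q y i.
Proof.
have [a a_gt0 qE] := q_power.
have q_gt1 : 1 < q by rewrite qE -(exp1n a) ltn_exp2r ?prime_gt1.
have co_lq i : coprime (l i) q.
  by rewrite qE coprimeXr // prime_coprime // dvdn_prime2.
split; last exact: tauE.
apply: card_cyclotomic_coset => [|||t].
- by rewrite prodn_gt0 // => i; rewrite expn_gt0 prime_gt0.
- exact: tau_gt0.
- by rewrite /modulus; elim/big_ind: _ => [|m n co_m co_n|i _]; rewrite ?coprime1n ?coprimeMl ?co_m ?coprimeXl.
rewrite -[X in (_ - X)%R]mulr1 -mulrBr.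
have le_ye i : y i <= e i by have [] := yx_applicable i.
have co_l_eta := coprime_primitive_root_system _ _ _ _ e_gt0 eta_prs.
(* As [q ^ t] is at least 1, truncated and integer subtraction agree. Both sides then become the
   same family of divisibilities by [l i ^ (e i - y i)]. *)
have -> : ((q ^ t)%N%:Z - 1 = (q ^ t - 1)%N%:Z)%R.
  by rewrite subzn // expn_gt0 (ltnW q_gt1).
by apply/dvdn_biglcm_ordP/dvdz_eta_pow.
Qed.
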